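(* Let $\Gamma$ be a set of sequents and $\Gamma^\exists=\{A^\exists\Rightarrow B^\exists\mid A\Rightarrow B\in\Gamma\}$. If $\mathbf{HA}+\Gamma^\exists\nvdash\top\Rightarrow\bot$, then $\mathbf{BA}+\Gamma^\exists\nvdash\mathbf{MRDP}^w$, i.e. there is a $\Sigma_1$ formula $A$ such that for no $\exists_1^+$ formula $B$ with the same free variables as $A$ does $\mathbf{BA}+\Gamma^\exists$ prove $\top\Rightarrow(A\to B)\land(B\to A)$.
   Context: Basic Arithmetic $\mathbf{BA}$ (Ruitenburg) is the following theory of sequents $A\Rightarrow B$ in the language $\{0,S,+,\cdot\}$, where formulas are built from atomic formulas ($s=t$, $\top$, $\bot$) by $\land,\lor,\exists x$ and the former $\forall\mathbf x(A\to B)$ ($\mathbf x$ a finite, possibly empty, sequence of variables; empty gives $A\to B$). Logical part (Basic Predicate Calculus): axioms $A\Rightarrow A$; $A\Rightarrow\top$; $\bot\Rightarrow A$; $A\land(B\lor C)\Rightarrow(A\land B)\lor(A\land C)$; $A\land\exists xB\Rightarrow\exists x(A\land B)$ ($x$ not free in $A$); $\top\Rightarrow x=x$; $x=y\land A\Rightarrow A[x/y]$ ($A$ atomic); $\forall\mathbf x(A\to B)\land\forall\mathbf x(B\to C)\Rightarrow\forall\mathbf x(A\to C)$; $\forall\mathbf x(A\to B)\land\forall\mathbf x(A\to C)\Rightarrow\forall\mathbf x(A\to B\land C)$; $\forall\mathbf x(B\to A)\land\forall\mathbf x(C\to A)\Rightarrow\forall\mathbf x(B\lor C\to A)$; $\forall\mathbf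 x(A\to B)\Rightarrow\forall\mathbf x(A[\mathbf x/\mathbf t]\to B[\mathbf x/\mathbf t])$; $\forall\mathbf x(A\to B)\Rightarrow\forall\mathbf y(A\to B)$ (no variable of $\mathbf y$ free on the left); $\forall\mathbf yx(B\to A)\Rightarrow\forall\mathbf y(\exists xB\to A)$ ($x$ not free in $A$); rules: transitivity; $A\Rightarrow B\land C$ iff $A\Rightarrow B$ and $A\Rightarrow C$; $B\lor C\Rightarrow A$ iff $B\Rightarrow A$ and $C\Rightarrow A$; term substitution; $\exists xB\Rightarrow A$ iff $B\Rightarrow A$ ($x$ not free in $A$); from $A\land B\Rightarrow C$ infer $A\Rightarrow\forall\mathbf x(B\to C)$ (no variable of $\mathbf x$ free in $A$). Arithmetic part: $Sx=0\Rightarrow\bot$; $Sx=Sy\Rightarrow x=y$; $x+0=x$; $x+Sy=S(x+y)$; $x\cdot0=0$; $x\cdot Sy=x\cdot y+x$; induction axiom schema $\forall\mathbf yx(A\to A[x/Sx])\Rightarrow\forall\mathbf yx(A[x/0]\to A)$; induction rule: from $A\Rightarrow A[x/Sx]$ infer $A[x/0]\Rightarrow A$. Heyting arithmetic $\mathbf{HA}$ is $\mathbf{BA}$ plus the schema $(\top\to A)\Rightarrow A$ (i.e. $\mathbf{BA}$ over intuitionistic logic). For a set $\Delta$ of sequents, $T+\Delta$ is $T$ with these sequents added as axioms. Positive part: $A^\exists=A$ for atomic $A$; $(A'\circ A'')^\exists=A'^\exists\circ A''^\exists$ for $\circ\in\{\land,\lor\}$; $(\exists uA')^\exists=\exists uA'^\exists$;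 $(\forall\mathbf u(A'\to A''))^\exists=\top$. $s<t$ abbreviates $\exists x(s+Sx=t)$. $\Delta_0$: smallest class containing atomic formulas, closed under $\land,\lor,\to$ and bounded quantifiers $\exists x(x<s\land A)$, $\forall x(x<s\to A)$; $\Sigma_1$: $\exists\mathbf xA$ with $A\in\Delta_0$; $\exists_1^+$: $\exists\mathbf xA$ with $A$ quantifier-free without $\to$. *)

(* Defs.v *)
From mathcomp Require Import all_boot.
Set Implicit Arguments.
Unset Strict Implicit.
Unset Printing Implicit Defensive.

Definition var := nat.

Inductive term : Type :=
| Var of var
| Zero
| Succ of term
| Add of term & term
| Mul of term & term.

(* [All xs A B] is the single former "forall xs (A -> B)"; there is no other
   universal quantifier and no other implication. *)
Inductive formula : Type :=
| Eq of term & term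
| Top
| Bot
| And of formula & formula
| Or of formula & formula
| Ex of var & formula
| All of seq var & formula & formula.

Definition Imp (A B : formula) : formula := All [::] A B.

Record sequent : Type := Sequent { ante : formula; succe : formula }.

Declare Scope ba_scope.
Delimit Scope ba_scope with BA.
Bind Scope ba_scope with term.
Bind Scope ba_scope with formula.
Bind Scope ba_scope with sequent.
Notation "s ≐ t" := (Eq s t) (at level 70, no associativity) : ba_scope.
Notation "⊤" := Top (at level 0) : ba_scope.
Notation "⊥" := Bot (at level 0) : ba_scope.
Notation "A ∧ B" := (And A B) (at level 80, right associativity) : ba_scope.
Notation "A ∨ B" := (Or A B) (at level 85, right associativity) : ba_scope.
Notation "A ⟶ B" := (Imp A B) (at level 90, right associativity) : ba_scope.
Notation "A ⇒ B" := (Sequent A B) (at level 95, no associativity) : ba_scope.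
Local Open Scope ba_scope.

Fixpoint tvars (t : term) : seq var :=
  match t with
  | Var v => [:: v]
  | Zero => [::]
  | Succ s => tvars s
  | Add s u | Mul s u => tvars s ++ tvars u
  end.

Fixpoint fv (A : formula) : seq var :=
  match A with
  | Eq s t => tvars s ++ tvars t
  | Top | Bot => [::]
  | And B C | Or B C => fv B ++ fv C
  | Ex x B => [seq v <- fv B | v != x]
  | All xs B C => [seq v <- fv B ++ fv C | v \notin xs]
  end.

Fixpoint tsubst (sigma : var -> term) (t : term) : term :=
  match t with
  | Var v => sigma v
  | Zero => Zero
  | Succ s => Succ (tsubst sigma s)
  | Add s u => Add (tsubst sigma s) (tsubst sigma u)
  | Mul s u => Mul (tsubst sigma s) (tsubst sigma u)
  end.

Definition mask_subst (xs : seq var) (sigma : var -> term) : var -> term :=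
  fun v => if v \in xs then Var v else sigma v.

(* Replaces free occurrences only and never renames bound variables: it is the
   usual substitution exactly when [free_for sigma A] holds. *)
Fixpoint subst (sigma : var -> term) (A : formula) : formula :=
  match A with
  | Eq s t => Eq (tsubst sigma s) (tsubst sigma t)
  | Top => Top
  | Bot => Bot
  | And B C => And (subst sigma B) (subst sigma C)
  | Or B C => Or (subst sigma B) (subst sigma C)
  | Ex x B => Ex x (subst (mask_subst [:: x] sigma) B)
  | All xs B C =>
      All xs (subst (mask_subst xs sigma) B) (subst (mask_subst xs sigma) C)
  end.

Fixpoint free_for (sigma : var -> term) (A : formula) : bool :=
  match A with
  | Eq _ _ | Top | Bot => true
  | And B C | Or B C => free_for sigma B && free_for sigma C
  | Ex x B =>
      all (fun v => x \notin tvars (sigma v)) (fv A)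
      && free_for (mask_subst [:: x] sigma) B
  | All xs B C =>
      all (fun v => ~~ has [in xs] (tvars (sigma v))) (fv A)
      && (free_for (mask_subst xs sigma) B && free_for (mask_subst xs sigma) C)
  end.

(* Simultaneous substitution of [ts] for the variables [xs], to be used with
   [uniq xs] and [size ts = size xs]; variables outside [xs] are fixed, since
   [index] then returns [size xs]. *)
Definition sub_seq (xs : seq var) (ts : seq term) : var -> term :=
  fun v => nth (Var v) ts (index v xs).

Definition sub1 (x : var) (t : term) : var -> term := sub_seq [:: x] [:: t].

Definition atomic (A : formula) : bool :=
  match A with Eq _ _ | Top | Bot => true | _ => false end.

Notation "A ⟨ x / t ⟩" := (subst (sub1 x t) A)
  (at level 2, left associativity, x at level 0, t at level 30,
   format "A ⟨ x  /  t ⟩") : ba_scope.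

(* Derivability of a sequent in BA with the sequents of [Delta] as additional
   axioms. The side condition [free_for] is omitted where it holds
   automatically: A atomic, or the term substituted for x is Zero or Succ x. *)
Inductive BA_plus (Delta : sequent -> Prop) : sequent -> Prop :=
| BA_ax S : Delta S -> BA_plus Delta S
| BA_refl A : BA_plus Delta (A ⇒ A)
| BA_top A : BA_plus Delta (A ⇒ ⊤)
| BA_bot A : BA_plus Delta (⊥ ⇒ A)
| BA_distr A B C : BA_plus Delta (A ∧ (B ∨ C) ⇒ (A ∧ B) ∨ (A ∧ C))
| BA_frob (x : var) A B :
    x \notin fv A -> BA_plus Delta (A ∧ Ex x B ⇒ Ex x (A ∧ B))
| BA_eqrefl x : BA_plus Delta (⊤ ⇒ Var x ≐ Var x)
| BA_eqsubst x y A :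
    atomic A -> BA_plus Delta ((Var x ≐ Var y) ∧ A ⇒ A⟨x / Var y⟩)
| BA_all_trans xs A B C :
    BA_plus Delta (All xs A B ∧ All xs B C ⇒ All xs A C)
| BA_all_and xs A B C :
    BA_plus Delta (All xs A B ∧ All xs A C ⇒ All xs A (B ∧ C))
| BA_all_or xs A B C :
    BA_plus Delta (All xs B A ∧ All xs C A ⇒ All xs (B ∨ C) A)
| BA_all_inst (xs : seq var) ts A B :
    uniq xs -> size ts = size xs ->
    free_for (sub_seq xs ts) A -> free_for (sub_seq xs ts) B ->
    BA_plus Delta
      (All xs A B ⇒ All xs (subst (sub_seq xs ts) A) (subst (sub_seq xs ts) B))
| BA_all_gen (xs ys : seq var) A B :
    {in ys, forall y, y \notin fv (All xs A B)} ->
    BA_plus Delta (All xs A B ⇒ All ys A B)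
| BA_all_ex (ys : seq var) (x : var) A B :
    x \notin fv A ->
    BA_plus Delta (All (rcons ys x) B A ⇒ All ys (Ex x B) A)
| BA_trans A B C :
    BA_plus Delta (A ⇒ B) -> BA_plus Delta (B ⇒ C) -> BA_plus Delta (A ⇒ C)
| BA_and_intro A B C :
    BA_plus Delta (A ⇒ B) -> BA_plus Delta (A ⇒ C) ->
    BA_plus Delta (A ⇒ B ∧ C)
| BA_and_elim1 A B C : BA_plus Delta (A ⇒ B ∧ C) -> BA_plus Delta (A ⇒ B)
| BA_and_elim2 A B C : BA_plus Delta (A ⇒ B ∧ C) -> BA_plus Delta (A ⇒ C)
| BA_or_intro A B C :
    BA_plus Delta (B ⇒ A) -> BA_plus Delta (C ⇒ A) ->
    BA_plus Delta (B ∨ C ⇒ A)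
| BA_or_elim1 A B C : BA_plus Delta (B ∨ C ⇒ A) -> BA_plus Delta (B ⇒ A)
| BA_or_elim2 A B C : BA_plus Delta (B ∨ C ⇒ A) -> BA_plus Delta (C ⇒ A)
| BA_subst x t A B :
    free_for (sub1 x t) A -> free_for (sub1 x t) B ->
    BA_plus Delta (A ⇒ B) -> BA_plus Delta (A⟨x / t⟩ ⇒ B⟨x / t⟩)
| BA_ex_intro (x : var) A B :
    x \notin fv A -> BA_plus Delta (B ⇒ A) -> BA_plus Delta (Ex x B ⇒ A)
| BA_ex_elim (x : var) A B :
    x \notin fv A -> BA_plus Delta (Ex x B ⇒ A) -> BA_plus Delta (B ⇒ A)
| BA_all_intro (xs : seq var) A B C :
    {in xs, forall x, x \notin fv A} ->
    BA_plus Delta (A ∧ B ⇒ C) -> BA_plus Delta (A ⇒ All xs B C)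
| BA_succ0 x : BA_plus Delta (Succ (Var x) ≐ Zero ⇒ ⊥)
| BA_succ_inj x y :
    BA_plus Delta (Succ (Var x) ≐ Succ (Var y) ⇒ Var x ≐ Var y)
| BA_add0 x : BA_plus Delta (⊤ ⇒ Add (Var x) Zero ≐ Var x)
| BA_addS x y :
    BA_plus Delta
      (⊤ ⇒ Add (Var x) (Succ (Var y)) ≐ Succ (Add (Var x) (Var y)))
| BA_mul0 x : BA_plus Delta (⊤ ⇒ Mul (Var x) Zero ≐ Zero)
| BA_mulS x y :
    BA_plus Delta
      (⊤ ⇒ Mul (Var x) (Succ (Var y)) ≐ Add (Mul (Var x) (Var y)) (Var x))
| BA_ind_axiom ys x A :
    BA_plus Delta
      (All (rcons ys x) A A⟨x / Succ (Var x)⟩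
       ⇒ All (rcons ys x) A⟨x / Zero⟩ A)
| BA_ind_rule x A :
    BA_plus Delta (A ⇒ A⟨x / Succ (Var x)⟩) -> BA_plus Delta (A⟨x / Zero⟩ ⇒ A).

Definition HA_schema (S : sequent) : Prop :=
  exists A : formula, S = ((⊤ ⟶ A) ⇒ A).

Definition HA_plus (Delta : sequent -> Prop) : sequent -> Prop :=
  BA_plus (fun S => Delta S \/ HA_schema S).

Fixpoint pos (A : formula) : formula :=
  match A with
  | Eq _ _ | Top | Bot => A
  | And B C => pos B ∧ pos C
  | Or B C => pos B ∨ pos C
  | Ex x B => Ex x (pos B)
  | All _ _ _ => ⊤
  end.

Definition pos_set (Gamma : sequent -> Prop) (S : sequent) : Prop :=
  exists A B : formula, Gamma (A ⇒ B) /\ S = (pos A ⇒ pos B).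

Definition Exs (xs : seq var) (A : formula) : formula := foldr Ex A xs.

(* "s < t" with [z] as the bound variable of the abbreviation; meaningful only
   when [z] occurs neither in [s] nor in [t]. *)
Definition lt (z : var) (s t : term) : formula :=
  Ex z (Add s (Succ (Var z)) ≐ t).

Inductive Delta0 : formula -> Prop :=
| Delta0_atomic A : atomic A -> Delta0 A
| Delta0_and A B : Delta0 A -> Delta0 B -> Delta0 (A ∧ B)
| Delta0_or A B : Delta0 A -> Delta0 B -> Delta0 (A ∨ B)
| Delta0_imp A B : Delta0 A -> Delta0 B -> Delta0 (A ⟶ B)
| Delta0_ex (x z : var) s A :
    x \notin tvars s -> z \notin x :: tvars s ->
    Delta0 A -> Delta0 (Ex x (lt z (Var x) s ∧ A))
| Delta0_all (x z : var) s A :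
    x \notin tvars s -> z \notin x :: tvars s ->
    Delta0 A -> Delta0 (All [:: x] (lt z (Var x) s) A).

Definition Sigma1 (A : formula) : Prop :=
  exists xs B, Delta0 B /\ A = Exs xs B.

Fixpoint qf_pos (A : formula) : bool :=
  match A with
  | Eq _ _ | Top | Bot => true
  | And B C | Or B C => qf_pos B && qf_pos C
  | Ex _ _ | All _ _ _ => false
  end.

Definition ExPos1 (A : formula) : Prop :=
  exists xs B, qf_pos B /\ A = Exs xs B.

(* Main.v *)
Require Import Defs.
From mathcomp Require Import all_boot.
Local Open Scope ba_scope.

(** The witness is the closed formula [⊤ ⟶ ⊥].  In a Kripke model for basic
    logic it holds at an irreflexive terminal node and fails at a reflexive
    one, whereas the truth of an [ExPos1] formula only depends on the structure
    attached to the node.  Syntactically: [pos] is truth at an irreflexive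
    terminal node, and [pos_above] is truth at an irreflexive node lying just
    below such a terminal node with the same structure.  Both translations
    preserve derivability over positive axioms, so [⊤ ⇒ ((⊤ ⟶ ⊥) ⟶ B)] yields
    [⊤ ⇒ (⊤ ⟶ B)], whence [⊤ ⇒ B] in HA, while [⊤ ⇒ (B ⟶ (⊤ ⟶ ⊥))] yields
    [B ⇒ ⊥] in HA. *)

(** An irreflexive node tests an [All] only at nodes strictly above it; here that is the terminal
    node, where truth is [pos]. *)
Fixpoint pos_above (A : formula) : formula :=
  match A with
  | Eq _ _ | Top | Bot => A
  | And B C => pos_above B ∧ pos_above C
  | Or B C => pos_above B ∨ pos_above C
  | Ex x B => Ex x (pos_above B)
  | All xs B C => All xs (pos B) (pos C)
  end.

(** Equivalently, [All] does not occur in [A]. *)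
Definition positive (A : formula) : Prop := pos A = A.

Lemma pos_positive A : positive (pos A).
Proof.
by rewrite /positive; elim: A => //= [A -> B ->|A -> B ->|x A ->].
Qed.

Lemma pos_above_positive A : positive A -> pos_above A = A.
Proof.
rewrite /positive; elim: A => //=.
- by move=> A IHA B IHB [/IHA -> /IHB ->].
- by move=> A IHA B IHB [/IHA -> /IHB ->].
- by move=> x A IHA [/IHA ->].
Qed.

Lemma ExPos1_positive B : ExPos1 B -> positive B.
Proof.
rewrite /positive => -[xs [C [qfC ->]]].
elim: xs => [|x xs /= -> //]; elim: C qfC => //=.
- by move=> A IHA B' IHB /andP[/IHA -> /IHB ->].
- by move=> A IHA B' IHB /andP[/IHA -> /IHB ->].
Qed.

Lemma pos_subst sigma A : pos (subst sigma A) = subst sigma (pos A).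
Proof.
by elim: A sigma => //= [A IHA B IHB|A IHA B IHB|x A IHA] sigma;
  rewrite ?IHA ?IHB.
Qed.

Lemma pos_above_subst sigma A :
  pos_above (subst sigma A) = subst sigma (pos_above A).
Proof.
by elim: A sigma => //= [A IHA B IHB|A IHA B IHB|x A IHA|xs A _ B _] sigma;
  rewrite ?IHA ?IHB ?pos_subst.
Qed.

Lemma sub_cat (T : eqType) (s1 s2 t1 t2 : seq T) :
  {subset s1 <= t1} -> {subset s2 <= t2} -> {subset s1 ++ s2 <= t1 ++ t2}.
Proof.
by move=> s1t1 s2t2 x; rewrite !mem_cat => /orP[/s1t1|/s2t2] ->; rewrite ?orbT.
Qed.

Lemma sub_filter (T : eqType) (a : pred T) (s t : seq T) :
  {subset s <= t} -> {subset filter a s <= filter a t}.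
Proof. by move=> st x; rewrite !mem_filter => /andP[-> /st]. Qed.

(** Erasing an [All] can only lose free variables; this carries the freshness side conditions of the
    rules over to the translation. *)
Lemma fv_pos A : {subset fv (pos A) <= fv A}.
Proof.
elim: A => [s t|||A IHA B IHB|A IHA B IHB|x A IHA|xs A _ B _] //=.
- exact: sub_cat.
- exact: sub_cat.
- exact: sub_filter.
Qed.

Lemma fv_pos_above A : {subset fv (pos_above A) <= fv A}.
Proof.
elim: A => [s t|||A IHA B IHB|A IHA B IHB|x A IHA|xs A _ B _] //=.
- exact: sub_cat.
- exact: sub_cat.
- exact: sub_filter.
- by apply: sub_filter; apply: sub_cat; apply: fv_pos.
Qed.

Lemma notin_fv_pos {x A} : x \notin fv A -> x \notin fv (pos A).
Proof. by apply: contra => /fv_pos. Qed.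

Lemma notin_fv_pos_above {x A} : x \notin fv A -> x \notin fv (pos_above A).
Proof. by apply: contra => /fv_pos_above. Qed.

Lemma free_for_pos {sigma A} : free_for sigma A -> free_for sigma (pos A).
Proof.
elim: A sigma => //= [A IHA B IHB|A IHA B IHB|x A IHA] sigma /andP[].
- by move=> /IHA -> /IHB ->.
- by move=> /IHA -> /IHB ->.
- move=> /allP nx /IHA ->; rewrite andbT; apply/allP => v v_in.
  by apply: nx; apply: sub_filter v_in; apply: fv_pos.
Qed.

Lemma free_for_pos_above {sigma A} :
  free_for sigma A -> free_for sigma (pos_above A).
Proof.
elim: A sigma => //= [A IHA B IHB|A IHA B IHB|x A IHA|xs A _ B _] sigma /andP[].
- by move=> /IHA -> /IHB ->.
- by move=> /IHA -> /IHB ->.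
- move=> /allP nx /IHA ->; rewrite andbT; apply/allP => v v_in.
  by apply: nx; apply: sub_filter v_in; apply: fv_pos_above.
- move=> /allP nxs /andP[/free_for_pos -> /free_for_pos ->].
  rewrite !andbT; apply/allP => v v_in; apply: nxs.
  by apply: sub_filter v_in; apply: sub_cat; apply: fv_pos.
Qed.

Lemma BA_and1 Delta A B : BA_plus Delta (A ∧ B ⇒ A).
Proof. exact: BA_and_elim1 (BA_refl _ _). Qed.

Lemma BA_and2 Delta A B : BA_plus Delta (A ∧ B ⇒ B).
Proof. exact: BA_and_elim2 (BA_refl _ _). Qed.

Lemma BA_and_mono {Delta A B C D} :
  BA_plus Delta (A ⇒ C) -> BA_plus Delta (B ⇒ D) ->
  BA_plus Delta (A ∧ B ⇒ C ∧ D).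
Proof.
move=> AC BD; apply: BA_and_intro.
- exact: BA_trans (BA_and1 _ _ _) AC.
- exact: BA_trans (BA_and2 _ _ _) BD.
Qed.

Lemma BA_ex_mono Delta x A B :
  BA_plus Delta (A ⇒ B) -> BA_plus Delta (Ex x A ⇒ Ex x B).
Proof.
have x_notin : x \notin fv (Ex x B) by rewrite mem_filter eqxx.
move=> AB; apply: BA_ex_intro => //; apply: BA_trans AB _.
exact: BA_ex_elim (BA_refl _ _).
Qed.

(* Persistence of truth from a node to the terminal node above it. *)
Lemma BA_pos_above_pos Delta A : BA_plus Delta (pos_above A ⇒ pos A).
Proof.
elim: A => /= [s t|||A IHA B IHB|A IHA B IHB|x A IHA|xs A _ B _];
  try exact: BA_refl; try exact: BA_top.
- exact: BA_and_mono.
- apply: BA_or_intro; [apply: BA_trans IHA _|apply: BA_trans IHB _].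
  + exact: BA_or_elim1 (BA_refl _ _).
  + exact: BA_or_elim2 (BA_refl _ _).
- exact: BA_ex_mono.
Qed.

Section PositiveAxioms.
Variable Delta : sequent -> Prop.
Hypothesis Delta_pos :
  forall S, Delta S -> positive (ante S) /\ positive (succe S).

(** Axioms in [Delta] are their own translation. Axioms and rules concluding an [All] become
    trivial, since that [All] turns into [⊤]; the others are mapped to instances of themselves. *)
Lemma BA_pos S : BA_plus Delta S -> BA_plus Delta (pos (ante S) ⇒ pos (succe S)).
Proof.
elim=> {S} /=.
- by move=> [A B] DS; have [/= -> ->] := Delta_pos _ DS; apply: BA_ax.
- by move=> A; apply: BA_refl.
- by move=> A; apply: BA_top.
- by move=> A; apply: BA_bot.
- by move=> A B C; apply: BA_distr.
- by move=> x A B xA; apply: BA_frob; apply: notin_fv_pos.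
- exact: BA_eqrefl.
- by move=> x y [] //= *; apply: BA_eqsubst.
- by move=> *; apply: BA_top.
- by move=> *; apply: BA_top.
- by move=> *; apply: BA_top.
- by move=> *; apply: BA_top.
- by move=> *; apply: BA_top.
- by move=> *; apply: BA_top.
- by move=> A B C _ AB _; apply: BA_trans.
- by move=> A B C _ AB _; apply: BA_and_intro.
- by move=> A B C _; apply: BA_and_elim1.
- by move=> A B C _; apply: BA_and_elim2.
- by move=> A B C _ BA _; apply: BA_or_intro.
- by move=> A B C _; apply: BA_or_elim1.
- by move=> A B C _; apply: BA_or_elim2.
- move=> x t A B fA fB _ AB; rewrite !pos_subst.
  by apply: BA_subst => //; apply: free_for_pos.
- by move=> x A B xA _; apply: BA_ex_intro; apply: notin_fv_pos.
- by move=> x A B xA _; apply: BA_ex_elim; apply: notin_fv_pos.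
- by move=> *; apply: BA_top.
- exact: BA_succ0.
- exact: BA_succ_inj.
- exact: BA_add0.
- exact: BA_addS.
- exact: BA_mul0.
- exact: BA_mulS.
- by move=> *; apply: BA_top.
- by move=> x A _; rewrite !pos_subst; apply: BA_ind_rule.
Qed.

(** The axioms relating [All] formulas, induction included, become the same axioms for the [pos]
    images. Only the introduction of [All] mixes the two nodes. *)
Lemma BA_pos_above S :
  BA_plus Delta S -> BA_plus Delta (pos_above (ante S) ⇒ pos_above (succe S)).
Proof.
elim=> {S} /=.
- move=> [A B] DS; have [/= pA pB] := Delta_pos _ DS.
  by rewrite !pos_above_positive //; apply: BA_ax.
- by move=> A; apply: BA_refl.
- by move=> A; apply: BA_top.
- by move=> A; apply: BA_bot.
- by move=> A B C; apply: BA_distr.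
- by move=> x A B xA; apply: BA_frob; apply: notin_fv_pos_above.
- exact: BA_eqrefl.
- by move=> x y [] //= *; apply: BA_eqsubst.
- by move=> *; apply: BA_all_trans.
- by move=> *; apply: BA_all_and.
- by move=> *; apply: BA_all_or.
- move=> xs ts A B uxs sz fA fB; rewrite !pos_subst.
  by apply: BA_all_inst => //; apply: free_for_pos.
- move=> xs ys A B nys; apply: BA_all_gen => y /nys.
  exact: (@notin_fv_pos_above y (All xs A B)).
- by move=> ys x A B xA; apply: BA_all_ex; apply: notin_fv_pos.
- by move=> A B C _ AB _; apply: BA_trans.
- by move=> A B C _ AB _; apply: BA_and_intro.
- by move=> A B C _; apply: BA_and_elim1.
- by move=> A B C _; apply: BA_and_elim2.
- by move=> A B C _ BA _; apply: BA_or_intro.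
- by move=> A B C _; apply: BA_or_elim1.
- by move=> A B C _; apply: BA_or_elim2.
- move=> x t A B fA fB _ AB; rewrite !pos_above_subst.
  by apply: BA_subst => //; apply: free_for_pos_above.
- by move=> x A B xA _; apply: BA_ex_intro; apply: notin_fv_pos_above.
- by move=> x A B xA _; apply: BA_ex_elim; apply: notin_fv_pos_above.
- move=> xs A B C xsA ABC _; apply: BA_all_intro.
    by move=> x /xsA; apply: notin_fv_pos_above.
  (* The new [All] is tested at the terminal node, so its premise is translated by [pos];
     persistence takes [pos_above A] to [pos A]. *)
  apply: BA_trans (BA_pos _ ABC).
  exact: BA_and_mono (BA_pos_above_pos _ _) (BA_refl _ _).
- exact: BA_succ0.
- exact: BA_succ_inj.
- exact: BA_add0.
- exact: BA_addS.
- exact: BA_mul0.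
- exact: BA_mulS.
- by move=> ys x A; rewrite !pos_subst; apply: BA_ind_axiom.
- by move=> x A _; rewrite !pos_above_subst; apply: BA_ind_rule.
Qed.

End PositiveAxioms.

Lemma BA_plus_mono (Delta Delta' : sequent -> Prop) :
  (forall S, Delta S -> Delta' S) ->
  forall S, BA_plus Delta S -> BA_plus Delta' S.
Proof.
move=> sub S; elim=> {S}; first by move=> S /sub; apply: BA_ax.
all: by intros; econstructor; eassumption.
Qed.

Lemma HA_top_imp Delta A B :
  HA_plus Delta (A ⇒ (⊤ ⟶ B)) -> HA_plus Delta (A ⇒ B).
Proof. by move=> H; apply: BA_trans H _; apply: BA_ax; right; exists B. Qed.

(** From [A] follows [⊤ ⟶ A]; composing with [A ⟶ B] gives [⊤ ⟶ B], and the schema of HA removes the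
    [⊤]. *)
Lemma HA_imp_elim Delta A B :
  HA_plus Delta (⊤ ⇒ (A ⟶ B)) -> HA_plus Delta (A ⇒ B).
Proof.
move=> AB; apply: HA_top_imp.
apply: (BA_trans (B := (⊤ ⟶ A) ∧ (A ⟶ B))); last exact: BA_all_trans.
apply: BA_and_intro; last exact: BA_trans (BA_top _ _) AB.
by apply: BA_all_intro => //; apply: BA_and1.
Qed.

Theorem theorem4p2 (Gamma : sequent -> Prop)
    (hcons : ~ HA_plus (pos_set Gamma) (⊤ ⇒ ⊥)) :
  exists A : formula, Sigma1 A /\
    forall B : formula, ExPos1 B -> fv B =i fv A ->
      ~ BA_plus (pos_set Gamma) (⊤ ⇒ (A ⟶ B) ∧ (B ⟶ A)).
Proof.
exists (⊤ ⟶ ⊥); split.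
  by exists [::], (⊤ ⟶ ⊥); split=> //; apply: Delta0_imp; apply: Delta0_atomic.
move=> B /ExPos1_positive posB _ AB; apply: hcons.
have BA_HA S : BA_plus (pos_set Gamma) S -> HA_plus (pos_set Gamma) S.
  by apply: BA_plus_mono; left.
have Gamma_pos S : pos_set Gamma S -> positive (ante S) /\ positive (succe S).
  by move=> [C [D [_ ->]]]; split; apply: pos_positive.
have : HA_plus (pos_set Gamma) (⊤ ⇒ (⊤ ⟶ B)).
  (* The inner [⊤ ⟶ ⊥] sits under an implication, so it is translated by [pos] and becomes [⊤]; what
     remains is [⊤ ⟶ pos B]. *)
  apply: BA_HA; have /= := BA_pos_above _ Gamma_pos _ (BA_and_elim1 AB).
  by rewrite posB.
move=> /HA_top_imp/BA_trans; apply.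
(* The converse implication is used untranslated: it gives [B ⇒ (⊤ ⟶ ⊥)], hence [B ⇒ ⊥] in HA. *)
exact: HA_top_imp (HA_imp_elim _ _ _ (BA_HA _ (BA_and_elim2 AB))).
Qed.
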